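(* Let $\mathcal{P}$ be a set of permutation matrices of order $n$ that are bisymmetric or $90^\circ$-symmetric, where from each pair $P, JP$ of such matrices exactly one is included in $\mathcal{P}$. Let $A$ be a magic square of order $n$ whose entries are pairwise distinct. Then the matrices $$P_iAP_i,\quad JP_iAP_i,\quad P_iAP_iJ,\quad JP_iAP_iJ,\quad P_iA^TP_i,\quad JP_iA^TP_i,\quad P_iA^TP_iJ,\quad JP_iA^TP_iJ,$$ with $P_i$ ranging over $\mathcal{P}$, are pairwise distinct magic squares, and the size of the set they form is $\rho(n)=4(B(n)+R(n))$.
   Context: Let $e_1,\dots,e_n$ be the standard basis column vectors of $\mathbb{R}^n$, $e\in\mathbb{R}^n$ the all-ones column vector, and $J$ the $n\times n$ reverse matrix, with $J_{i,j}=1$ if $i+j=n+1$ and $J_{i,j}=0$ otherwise. A magic square of order $n$ with magic number $\mu$ is a real $n\times n$ matrix $A$ with $e_i^TAe=\mu$ for all $i$, $e^TAe_j=\mu$ for all $j$, $\operatorname{tr}(A)=\mu$ and $\operatorname{tr}(JA)=\mu$. A square matrix $M$ is persymmetric if $JM=(JM)^T$, bisymmetric if it is both symmetric ($M=M^T$) and persymmetric, and $90^\circ$-symmetric if $M^T=JM$. If a matrix $P$ is bisymmetric (respectively $90^\circ$-symmetric), then so is $JP$. $B(n)$ denotes the number of bisymmetric permutation matrices of order $n$, and $R(n)$ denotes the number of $90^\circ$-symmetric permutation matrices of order $n$. *)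

(* Defs.v *)
From HB Require Import structures.
From mathcomp Require Import all_boot all_order all_fingroup all_algebra finmap reals.

Set Implicit Arguments.
Unset Strict Implicit.
Unset Printing Implicit Defensive.

Import GRing.Theory.
Local Open Scope ring_scope.
Local Open Scope fset_scope.

Section MagicSquares.
Variables (R : realType) (n : nat).
Implicit Types A M P : 'M[R]_n.

(* Indices start at 0, so the condition i + j = n + 1 on 1-based indices
   becomes i + j + 1 = n. *)
Definition reverse_mx : 'M[R]_n := \matrix_(i, j) ((i + j).+1 == n)%:R.

Local Notation J := reverse_mx.

Definition magic_square_with (mu : R) A : Prop :=
  [/\ forall i, \sum_j A i j = mu,
      forall j, \sum_i A i j = mu,
      \tr A = mu
    & \tr (J *m A) = mu].

Definition magic_square A : Prop := exists mu, magic_square_with mu A.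

Definition distinct_entries A : Prop :=
  injective (fun ij : 'I_n * 'I_n => A ij.1 ij.2).

Definition symmetric_mx M : bool := M == M^T.

Definition persymmetric M : bool := J *m M == (J *m M)^T.

Definition bisymmetric M : bool := symmetric_mx M && persymmetric M.

Definition symmetric90 M : bool := M^T == J *m M.

Definition perm_matrices : {fset 'M[R]_n} := [fset perm_mx s | s in {: 'S_n}].

Definition num_bisymmetric : nat :=
  #|` [fset M in perm_matrices | bisymmetric M]|.

Definition num_symmetric90 : nat :=
  #|` [fset M in perm_matrices | symmetric90 M]|.

Definition rho : nat := (4 * (num_bisymmetric + num_symmetric90))%N.

Definition bisym_or_sym90_perm P : bool :=
  is_perm_mx P && (bisymmetric P || symmetric90 P).

(* "Exactly one of P, JP" is an exclusive or, so P and JP are read as two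
   different matrices.  This holds for n >= 2; for n <= 1 we have JP = P and
   no selection exists, in accordance with the fact that the eight matrices
   below then coincide. *)
Definition selection (S : {fset 'M[R]_n}) : Prop :=
  (forall P, P \in S -> bisym_or_sym90_perm P) /\
  (forall P, bisym_or_sym90_perm P -> (P \in S) (+) (J *m P \in S)).

Definition eight_matrices A P : seq 'M[R]_n :=
  [:: P *m A *m P; J *m P *m A *m P;
      P *m A *m P *m J; J *m P *m A *m P *m J;
      P *m A^T *m P; J *m P *m A^T *m P;
      P *m A^T *m P *m J; J *m P *m A^T *m P *m J].

(* A list rather than a set, so that repetitions remain visible to [uniq]. *)
Definition transformed_squares A (S : {fset 'M[R]_n}) : seq 'M[R]_n :=
  [seq M | P <- S, M <- eight_matrices A P].

End MagicSquares.

(* Main.v *)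
Require Import Defs.
From mathcomp Require Import all_boot all_order all_fingroup all_algebra finmap reals.

Local Open Scope ring_scope.
Local Open Scope fset_scope.

(** Call a permutation matrix _admissible_ when it is bisymmetric or
    90-degree-symmetric.  An admissible [P] commutes with the reversal [J]: if
    [P] is bisymmetric then [J P = (J P)^T = P J], and if [P^T = J P] then
    transposing gives [P = P^T J], so that [P J = P^T = J P].  Moreover [P P] is
    [1] in the first case and [J P^T P = J] in the second one.

    Because of the commutation, each of the eight matrices built from [P] has
    the form [L B Q] with [L] and [Q] in [{P, J P}] and [B] in [{A, A^T}].

    - Such a matrix is magic.  Multiplying by permutation matrices only permutes
      the row sums and the column sums.  By cyclicity of the trace, the two
      diagonal sums of [L B Q] are the traces of [(Q L) B] and [(Q J L) B]; as
      [Q L] and [Q J L] lie in [{1, J}], these are diagonal sums of [B]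
      ([magic_perm_mul]).

    - When the entries of [A] are distinct, [L A Q] determines both [L] and [Q]
      ([perm_mul_inj]), and it can be equal to some [L' A^T Q'] only if [n <= 1]
      ([perm_mul_neq_tr]).  Then [J = 1] and [P = J P], so that there would be no
      selection.

    - A selection [S] contains one element of each pair [{P, J P}], which says
      exactly that sending [(P, b)] to [P] or [J P], according to the bit [b], is
      a bijection from [S * bool] onto the admissible matrices ([flip_inj],
      [mem_flips]).

    Injectivity of this last map makes the [8 * #|S|] matrices distinct, and its
    bijectivity gives [2 * #|S| = B(n) + R(n)], since no admissible matrix is of
    both kinds: it would satisfy [P = P^T = J P], which a selection excludes. *)

Import GRing.Theory.

(** * The reversal matrix and admissible permutation matrices *)

Section Admissible.

Set Implicit Arguments.
Unset Strict Implicit.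
Unset Printing Implicit Defensive.

Variables (R : realType) (n : nat).
Implicit Types P M : 'M[R]_n.
Local Notation J := (reverse_mx R n).

Lemma reverse_mxE : J = perm_mx (perm (@rev_ord_inj n)).
Proof.
apply/matrixP=> i j; rewrite !mxE permE -val_eqE /=; congr (nat_of_bool _)%:R.
by rewrite -[RHS](inj_eq (@addnI i.+1)) subnKC ?ltn_ord // eq_sym addSn.
Qed.

Lemma reverse_is_perm_mx : is_perm_mx J.
Proof. by rewrite reverse_mxE perm_mx_is_perm. Qed.

Lemma reverse_mxK : J *m J = 1%:M.
Proof.
rewrite reverse_mxE -perm_mxM -perm_mx1; congr perm_mx.
by apply/permP=> i; rewrite permM !permE rev_ordK.
Qed.

Lemma tr_reverse_mx : J^T = J.
Proof. by apply/matrixP=> i j; rewrite !mxE addnC. Qed.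

Lemma reverse_mulK m (M : 'M_(n, m)) : J *m (J *m M) = M.
Proof. by rewrite mulmxA reverse_mxK mul1mx. Qed.

Lemma perm_mx_trK P : is_perm_mx P -> P *m P^T = 1%:M.
Proof.
by case/is_perm_mxP=> s ->; rewrite tr_perm_mx -perm_mxM mulgV perm_mx1.
Qed.

Lemma bisymmetric_comm P : bisymmetric P -> J *m P = P *m J.
Proof.
case/andP=> /eqP symP /eqP persP.
by rewrite persP trmx_mul tr_reverse_mx -symP.
Qed.

Lemma symmetric90_comm P : symmetric90 P -> J *m P = P *m J.
Proof.
move/eqP=> trP; have /(congr1 (mulmx^~ J)) := congr1 trmx trP.
by rewrite trmxK trmx_mul tr_reverse_mx -mulmxA reverse_mxK mulmx1 trP => ->.
Qed.

Lemma admissible_comm P : bisym_or_sym90_perm P -> J *m P = P *m J.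
Proof. by case/andP=> _ /orP[/bisymmetric_comm|/symmetric90_comm]. Qed.

(** If [P^T = J P] then [P P = J (J P) P = J P^T P = J], by orthogonality. *)
Lemma admissible_sqr P :
  bisym_or_sym90_perm P -> P *m P = 1%:M \/ P *m P = J.
Proof.
case/andP=> permP /orP[/andP[/eqP symP _] | sym90P].
  by left; rewrite {2}symP perm_mx_trK.
right; have /eqP trP := sym90P.
rewrite -[in RHS](mulmx1 J) -(perm_mx_trK permP) trP !mulmxA.
by rewrite (symmetric90_comm sym90P) -!mulmxA reverse_mulK.
Qed.

Lemma admissible_reverse P :
  bisym_or_sym90_perm P -> bisym_or_sym90_perm (J *m P).
Proof.
move=> admP; have JP := admissible_comm admP.
case/andP: admP => permP kindP.
rewrite /bisym_or_sym90_perm is_perm_mxMl ?reverse_is_perm_mx // permP /=.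
case/orP: kindP => [/andP[/eqP symP _] | /eqP trP]; apply/orP; [left | right].
  rewrite /bisymmetric /symmetric_mx /persymmetric reverse_mulK.
  by rewrite trmx_mul tr_reverse_mx -symP JP !eqxx.
rewrite /symmetric90 reverse_mulK trmx_mul trP tr_reverse_mx.
by rewrite -mulmxA -JP reverse_mulK.
Qed.

(** * Magic squares under permutation of rows and columns *)

Lemma magic_square_with_tr mu M :
  magic_square_with mu M -> magic_square_with mu M^T.
Proof.
case=> rows cols diag antidiag; split.
- by move=> i; under eq_bigr do rewrite mxE.
- by move=> j; under eq_bigr do rewrite mxE.
- by rewrite mxtrace_tr.
- by rewrite mxtrace_mulC -{1}tr_reverse_mx -trmx_mul mxtrace_tr.
Qed.

Lemma perm_mul_mxE s t M i j :
  (perm_mx s *m M *m perm_mx t) i j = M (s i) ((t^-1)%g j).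
Proof. by rewrite -[t in LHS]invgK -col_permE -row_permE !mxE. Qed.

(** The trace of [L M Q] is that of [(Q L) M], and its antidiagonal sum, the
    trace of [J L M Q], is that of [(Q J L) M]; hence the two conditions. *)
Lemma magic_perm_mul mu M L Q :
    magic_square_with mu M -> is_perm_mx L -> is_perm_mx Q ->
    Q *m L = 1%:M \/ Q *m L = J -> Q *m J *m L = 1%:M \/ Q *m J *m L = J ->
  magic_square_with mu (L *m M *m Q).
Proof.
case=> rows cols diag antidiag /is_perm_mxP[s ->] /is_perm_mxP[t ->] QL QJL.
have trM K : K = 1%:M \/ K = J -> \tr (K *m M) = mu.
  by case=> ->; rewrite ?mul1mx.
split.
- move=> i; under eq_bigr do rewrite perm_mul_mxE.
  by rewrite -(rows (s i)) [RHS](reindex_perm (t^-1)%g).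
- move=> j; under eq_bigr do rewrite perm_mul_mxE.
  by rewrite -(cols ((t^-1)%g j)) [RHS](reindex_perm s).
- by rewrite mxtrace_mulC mulmxA trM.
- by rewrite mulmxA mxtrace_mulC !mulmxA trM.
Qed.

(** * Recovering the permutations when the entries are distinct *)

Lemma perm_mul_inj M L Q L' Q' :
    distinct_entries M ->
    is_perm_mx L -> is_perm_mx Q -> is_perm_mx L' -> is_perm_mx Q' ->
  L *m M *m Q = L' *m M *m Q' -> L = L' /\ Q = Q'.
Proof.
move=> injM /is_perm_mxP[s ->] /is_perm_mxP[t ->].
move=> /is_perm_mxP[s' ->] /is_perm_mxP[t' ->] eqM.
have eq_st i j : (s i, (t^-1)%g j) = (s' i, (t'^-1)%g j).
  by apply: injM; rewrite -!perm_mul_mxE eqM.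
split; congr perm_mx.
  by apply/permP=> i; case: (eq_st i i).
by apply: invg_inj; apply/permP=> i; case: (eq_st i i).
Qed.

(** Comparing positions, an equality would force the row permutation on the
    left to agree with the column permutation on the right, whatever the row
    and the column are; an injection that is constant has at most one point in
    its domain. *)
Lemma perm_mul_neq_tr M L Q L' Q' :
    distinct_entries M ->
    is_perm_mx L -> is_perm_mx Q -> is_perm_mx L' -> is_perm_mx Q' ->
  L *m M *m Q = L' *m M^T *m Q' -> forall i j : 'I_n, i = j.
Proof.
move=> injM /is_perm_mxP[s ->] /is_perm_mxP[t ->].
move=> /is_perm_mxP[s' ->] /is_perm_mxP[t' ->] eqM.
have eq_st i j : (s i, (t^-1)%g j) = ((t'^-1)%g j, s' i).
  by apply: injM; rewrite -perm_mul_mxE eqM perm_mul_mxE mxE.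
move=> i j; apply: (@perm_inj _ s).
by case: (eq_st i i) => -> _; case: (eq_st j i) => -> _.
Qed.

Lemma reverse_mx_eq1 : (forall i j : 'I_n, i = j) -> J = 1%:M.
Proof.
by move=> eqI; rewrite reverse_mxE -perm_mx1; congr perm_mx; apply/permP=> i.
Qed.

(** * Selections *)

Definition flip (b : bool) P := if b then J *m P else P.

Lemma flip_is_perm_mx b P :
  bisym_or_sym90_perm P -> is_perm_mx (flip b P).
Proof.
by case/andP=> permP _; case: b; rewrite //= is_perm_mxMl ?reverse_is_perm_mx.
Qed.

Lemma flip_mul b c P : bisym_or_sym90_perm P ->
  flip b P *m flip c P = flip (b (+) c) (P *m P).
Proof.
move=> /admissible_comm JP.
have PJP : P *m (J *m P) = J *m (P *m P) by rewrite mulmxA -JP -mulmxA.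
by case: b; case: c; rewrite /= -?mulmxA ?PJP ?reverse_mulK.
Qed.

Lemma admissible_sqr_flip b P : bisym_or_sym90_perm P ->
  flip b (P *m P) = 1%:M \/ flip b (P *m P) = J.
Proof.
by case: b => /admissible_sqr[] /= ->; rewrite ?mulmx1 ?reverse_mxK; auto.
Qed.

(** Reversing the right factor on its left, rather than on its right as in
    [P A P J], is harmless for admissible [P] and makes the two outer factors
    values of the single map [flip], whose injectivity then settles both. *)
Definition sandwich M P (c : bool * bool * bool) :=
  flip c.1.2 P *m (if c.1.1 then M^T else M) *m flip c.2 P.

(** The order of the codes is the one in which the eight matrices are listed. *)
Definition codes : seq (bool * bool * bool) :=
  [:: (false, false, false); (false, true, false);
      (false, false, true); (false, true, true);
      (true, false, false); (true, true, false);
      (true, false, true); (true, true, true)].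

Lemma eight_matricesE M P : bisym_or_sym90_perm P ->
  eight_matrices M P = [seq sandwich M P c | c <- codes].
Proof. by move=> /admissible_comm JP; rewrite /sandwich /= JP !mulmxA -JP. Qed.

Lemma magic_sandwich M P c : bisym_or_sym90_perm P ->
  magic_square M -> magic_square (sandwich M P c).
Proof.
case: c => -[t l] r admP [mu magicM]; exists mu.
apply: magic_perm_mul; rewrite ?flip_is_perm_mx //=.
- by case: t => //; apply: magic_square_with_tr.
- by rewrite flip_mul //; apply: admissible_sqr_flip.
have -> : flip r P *m J *m flip l P = flip r P *m flip (~~ l) P.
  by case: l; rewrite /= -mulmxA ?reverse_mulK.
by rewrite flip_mul //; apply: admissible_sqr_flip.
Qed.

Variable S : {fset 'M[R]_n}.
Hypothesis selS : selection S.

Lemma selection_reverseN P : P \in S -> J *m P \notin S.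
Proof.
by move=> PS; have := selS.2 _ (selS.1 _ PS); rewrite PS.
Qed.

(** For [n <= 1] the equality [J = 1] holds, so a selected matrix is evidence
    that [n >= 2], the range where the eight matrices can be distinct. *)
Lemma selection_reverse_neq1 P : P \in S -> J <> 1%:M.
Proof.
by move=> PS J1; have := selection_reverseN PS; rewrite J1 mul1mx PS.
Qed.

(** Reversing a selected matrix leads out of the selection, so the bit can be
    read off from the image. *)
Lemma flip_inj b c P P' :
  P \in S -> P' \in S -> flip b P = flip c P' -> P = P' /\ b = c.
Proof.
case: b; case: c => //= PS P'S eqP.
- by rewrite -(reverse_mulK P) eqP reverse_mulK.
- by have := selection_reverseN PS; rewrite eqP P'S.
- by have := selection_reverseN P'S; rewrite -eqP PS.
Qed.

Definition flips := [seq flip b P | P <- S, b <- [:: false; true]].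

(** The admissible matrices are closed under [P |-> J P], so the orbits of this
    involution are the pairs from which the selection takes one element. *)
Lemma mem_flips M : (M \in flips) = bisym_or_sym90_perm M.
Proof.
apply/allpairsP/idP=> [[[P b] /= [PS _ ->]] | admM].
  by case: b; rewrite /= ?admissible_reverse ?(selS.1 P).
have := selS.2 _ admM; case: (boolP (M \in S)) => /= MS JMS.
  by exists (M, false).
by exists (J *m M, true); rewrite /= reverse_mulK.
Qed.

Lemma flips_uniq : uniq flips.
Proof.
apply: (allpairs_uniq (fset_uniq S)) => //.
move=> u v /allpairsP[p [pS _ ->]] /allpairsP[q [qS _ ->]].
case: p q pS qS => [P b] [P' c] /= PS P'S eqf.
by have [-> ->] := flip_inj PS P'S eqf.
Qed.

(** Both sides count the admissible matrices: the two kinds are disjoint, as a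
    matrix of both kinds would satisfy [P = P^T = J P], although the flips of
    the selected matrices are pairwise distinct. *)
Lemma card_selection :
  (2 * #|` S| = num_bisymmetric R n + num_symmetric90 R n)%N.
Proof.
rewrite /num_bisymmetric /num_symmetric90 -cardfsUI.
have mem_perm M : (M \in perm_matrices R n) = is_perm_mx M.
  apply/imfsetP/is_perm_mxP => [[s _ ->] | [s ->]]; by exists s.
set U := (_ `|` _); set I := (_ `&` _).
have -> : I = fset0.
  apply/fsetP=> M; rewrite !inE /= mem_perm; apply/negP.
  case/andP=> /andP[permM bisM] /andP[_ sym90M].
  have : bisym_or_sym90_perm M by rewrite /bisym_or_sym90_perm permM bisM.
  move: bisM sym90M => /andP[/eqP symM _] /eqP eqM.
  by move/selS.2; rewrite -eqM -symM addbb.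
have -> : U = [fset M in flips].
  by apply/fsetP=> M; rewrite !inE /= !mem_perm mem_flips -andb_orr.
rewrite cardfs0 addn0 card_fseq undup_id ?flips_uniq //.
by rewrite size_allpairs mulnC.
Qed.

Lemma sandwich_inj M P P' c c' : distinct_entries M -> P \in S -> P' \in S ->
  sandwich M P c = sandwich M P' c' -> (P, c) = (P', c').
Proof.
move=> injM PS P'S.
have perm_flip b K : K \in S -> is_perm_mx (flip b K).
  by move=> KS; rewrite flip_is_perm_mx ?(selS.1 K).
case: c => -[t l] r; case: c' => -[t' l'] r'; rewrite /sandwich /=.
have [<- | ne_t] := eqVneq t t'; last first.
  (* Mixing [M] and [M^T] would make [n <= 1], hence [J = 1]. *)
  move=> eqM; case: (selection_reverse_neq1 PS); apply: reverse_mx_eq1.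
  by case: t t' ne_t eqM => -[] // _ => [/esym|];
    apply: perm_mul_neq_tr => //; apply: perm_flip.
have injB : distinct_entries (if t then M^T else M).
  case: t => // -[i j] [i' j'] /=; rewrite !mxE => /(injM (j, i) (j', i')).
  by case=> -> ->.
move=> eqM; have [eqL eqQ] := perm_mul_inj injB (perm_flip l P PS)
  (perm_flip r P PS) (perm_flip l' P' P'S) (perm_flip r' P' P'S) eqM.
have [<- <-] := flip_inj PS P'S eqL.
by have [_ <-] := flip_inj PS P'S eqQ.
Qed.

Lemma transformed_squaresE M :
  transformed_squares M S = [seq sandwich M P c | P <- S, c <- codes].
Proof.
rewrite /transformed_squares; congr flatten; apply/eq_in_map=> P PS.
by rewrite map_id eight_matricesE ?(selS.1 P).
Qed.

Lemma transformed_squares_uniq M :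
  distinct_entries M -> uniq (transformed_squares M S).
Proof.
move=> injM; rewrite transformed_squaresE; apply: (allpairs_uniq (fset_uniq S)) => //.
move=> u v /allpairsP[p [pS _ ->]] /allpairsP[q [qS _ ->]].
case: p q pS qS => [P c] [P' c'] /= PS P'S.
exact: sandwich_inj.
Qed.

End Admissible.

Theorem theorem5 (R : realType) (n : nat) (S : {fset 'M[R]_n}) (A : 'M[R]_n) :
  selection S ->
  magic_square A ->
  distinct_entries A ->
  [/\ forall M, M \in transformed_squares A S -> magic_square M,
      uniq (transformed_squares A S)
    & #|` [fset M in transformed_squares A S]| = rho R n].
Proof.
move=> selS magicA injA.
have uniqA := transformed_squares_uniq selS injA.
split=> // [M|].
  rewrite transformed_squaresE // => /allpairsP[[P c] /= [PS _ ->]].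
  exact: magic_sandwich (selS.1 _ PS) magicA.
rewrite card_fseq undup_id // transformed_squaresE // size_allpairs.
by rewrite /rho -(card_selection selS) mulnA mulnC.
Qed.
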